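(* Consider the partially observable restless bandit of the context with discount factor $\beta\in(0,1)$. For a single arm, let $\pi_{\beta,m}$ be the linearized threshold policy with a belief state $\omega$ fixed as a point in the threshold, and let $\hat V_{\beta,m}(\omega_1)$ be its value function. Define the passive time under $\pi_{\beta,m}$ by $$\hat{D}_{\beta,m}(\omega_1):= \mathbb{E}_{\pi_{\beta,m}}\Big[\sum_{t=1}^\infty\beta^{t-1}\mathbf{1}(u(t)=0)\,\Big|\,\omega(1)=\omega_1\Big];$$ it satisfies $\hat{D}_{\beta,m}(\omega_1)=\frac{d\hat{V}_{\beta, m}(\omega_1)}{dm}$. With $\omega$ fixed as a point in the threshold and with the $m$-independent threshold function $r(\omega)=\omega B'$, the passive time starting from any initial belief state $\omega_1$ is independent of $m$; denote it by $\hat{D}_{\beta}(\omega_1)$. The restless bandit satisfies the relaxed indexability (with respect to the linearized threshold policy) if and only if for any arm, for the corresponding single-armed bandit problem with subsidy $m$ and with any belief state $\omega$ fixed as a point in the threshold, $$\beta\,\omega\,(\hat{D}_{\beta}(p_0),\dots,\hat{D}_{\beta}(p_{K-1}))' \neq 1+\beta\hat{D}_{\beta}(\mathcal{T}^1(\omega)).$$ Under the relaxed indexability, the approximated Whittle index $\hat{W}(\omega)$ of a belief state $\omega$ is given by $$\hat{W}(\omega) = \frac{\omega B' - \beta g(\omega\mathbf{P})\big[\mathbf{I}_K + \beta H(\mathbf{P})G(\mathbf{P})\big]B' + \beta\omega H(\mathbf{P})G(\mathbf{P})B'}{1 + \beta f(\omega\mathbf{P}) + \beta\big[\beta g(\omega\mathbf{P})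 - \omega\big]H(\mathbf{P})F(\mathbf{P})},$$ where, for a belief state $x$, $L(x):=L(x,\omega)$, $f(x):=\frac{1-\beta^{L(x)}}{1-\beta}$, $g(x):=\beta^{L(x)}\mathcal{T}^{L(x)}(x)=\beta^{L(x)}x\mathbf{P}^{L(x)}$, $F(\mathbf{P})$ is the column vector with entries $f(p_0),\dots,f(p_{K-1})$, $G(\mathbf{P})$ is the $K\times K$ matrix with rows $g(p_0),\dots,g(p_{K-1})$, and $H(\mathbf{P})=(\mathbf{I}_K-\beta G(\mathbf{P}))^{-1}$.
   Context: There are $N$ independent arms. Each arm (index suppressed; parameters may differ across arms) is a Markov chain with state space $\{0,1,\dots,K-1\}$, transition matrix $\mathbf{P}=(p_{i,j})$ (assumed irreducible and aperiodic) and reward (row) vector $B=[B_0,\dots,B_{K-1}]$ with $0=B_0\le B_1\le\cdots\le B_{K-1}$. Write $p_k$ for the $k$-th row of $\mathbf{P}$, $'$ for transpose, $\mathbf{I}_K$ for the identity matrix. Belief states are probability row vectors $\omega=(\omega_0,\dots,\omega_{K-1})$ on the internal states, and $\mathcal{T}^k(\omega)=\omega\mathbf{P}^k$. Single arm with subsidy $m\in\mathbb{R}$: at each time $t\ge1$ an action $u(t)\in\{0,1\}$ is taken ($1$ = active, $0$ = passive). If $u(t)=1$, the internal state $S(t)$, distributed according to the current belief state $\omega(t)$, is observed, reward $B_{S(t)}$ is received, and $\omega(t+1)=p_{S(t)}$. If $u(t)=0$, the subsidy $m$ is received, nothing is observed, and $\omega(t+1)=\mathcal{T}^1(\omega(t))=\omega(t)\mathbf{P}$.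 Linearized threshold policy $\pi_{\beta,m}$ with belief state $\omega$ fixed as a point in the threshold: with threshold function $r(x)=xB'$, take $u(t)=1$ if $r(\omega(t))>r(\omega)$ and $u(t)=0$ if $r(\omega(t))\le r(\omega)$. Its value function $\hat V_{\beta,m}(\omega_1)$ is the expected total discounted reward (discount $\beta$, with reward $B_{S(t)}$ received at each time $t$ such that $u(t)=1$ and subsidy $m$ received at each time $t$ such that $u(t)=0$), i.e. $\hat V_{\beta,m}(\omega_1)=\mathbb{E}_{\pi_{\beta,m}}\big[\sum_{t=1}^\infty\beta^{t-1}\big(\mathbf{1}(u(t)=1)B_{S(t)}+m\,\mathbf{1}(u(t)=0)\big)\,\big|\,\omega(1)=\omega_1\big]$, under $\pi_{\beta,m}$ starting from belief state $\omega_1$. The first crossing time is $L(\omega_1,\omega)=\min_{0\le k<\infty}\{k:\mathcal{T}^k(\omega_1)B'>\omega B'\}$, and $L(\omega_1,\omega)=+\infty$ if no such $k$ exists; in that case $\beta^{+\infty}=0$, so $f(\omega_1)=\frac1{1-\beta}$ and $g(\omega_1)=0$. Relaxed indexability (with respect to the linearized threshold policy): for each arm and each belief state $\omega$ of that arm there exists a unique subsidy $m$ such that, when $\omega$ is fixed as a point in the threshold, taking the active and the passive action at $\omega$, each followed by the threshold policy, achieve the same performance, i.e. $$\omega B'+\beta\,\omega\,(\hat V_{\beta,m}(p_0),\dots,\hat V_{\beta,m}(p_{K-1}))'=m+\beta\hat V_{\beta,m}(\mathcal{T}^1(\omega)).$$ Under relaxed indexability, the approximated Whittle index $\hat W(\omega)$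 is this unique $m$. *)

(* Defs.v *)
(* MathComp / MathComp-Analysis world. *)
From HB Require Import structures.
From mathcomp Require Import all_boot all_order all_algebra.
From mathcomp Require Import all_classical all_reals all_analysis.

Set Implicit Arguments.
Unset Strict Implicit.
Unset Printing Implicit Defensive.

Import Order.TTheory GRing.Theory Num.Theory.
Import numFieldNormedType.Exports.

Local Open Scope classical_set_scope.
Local Open Scope ring_scope.

Definition is_distr (R : realType) (K : nat) (w : 'rV[R]_K) : Prop :=
  (forall i, 0 <= w 0 i) /\ \sum_i w 0 i = 1.

Definition stochastic (R : realType) (K : nat) (P : 'M[R]_K) : Prop :=
  forall i, is_distr (row i P).

Definition irreducible_mx (R : realType) (K : nat) (P : 'M[R]_K) : Prop :=
  forall i j, exists n, 0 < (P ^+ n) i j.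

(* Every state has period 1: the only common divisor of its possible return
   times is 1. *)
Definition aperiodic_mx (R : realType) (K : nat) (P : 'M[R]_K) : Prop :=
  forall (i : 'I_K) (d : nat),
    (forall n, (0 < n)%N -> 0 < (P ^+ n) i i -> (d %| n)%N) -> d = 1%N.

Record arm (R : realType) := Arm {
  nstates : nat ;
  trans : 'M[R]_nstates ;
  reward : 'rV[R]_nstates ;
  nstates_gt0 : (0 < nstates)%N ;
  trans_stochastic : stochastic trans ;
  trans_irreducible : irreducible_mx trans ;
  trans_aperiodic : aperiodic_mx trans ;
  reward0 : forall i : 'I_nstates, i = 0%N :> nat -> reward 0 i = 0 ;
  reward_mono : forall i j : 'I_nstates, (i <= j)%N -> reward 0 i <= reward 0 j
}.

(* Internal states as a Markov chain: [law w] is the probability on the sample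
   space under which the initial state has distribution [w].  Time is counted
   from 0, so [state t] is the state S(t+1) of a process started at time 1.
   The law is pinned down by its finite-dimensional distributions, and every
   arm admits such a chain, e.g. on path space. *)
Record chain (R : realType) (A : arm R) := Chain {
  chain_disp : measure_display ;
  space : measurableType chain_disp ;
  law : 'rV[R]_(nstates A) -> probability space R ;
  state : nat -> space -> 'I_(nstates A) ;
  state_measurable : forall t i, measurable (state t @^-1` [set i]) ;
  state_markov : forall w, is_distr w -> forall (n : nat) (s : nat -> 'I_(nstates A)),
    law w [set o | forall t, (t <= n)%N -> state t o = s t] =
      (w 0 (s 0%N) * \prod_(t < n) trans A (s t) (s t.+1))%:E
}.

Section SingleArm.
Variables (R : realType) (A : arm R).
Local Notation K := (nstates A).
Local Notation P := (trans A).
Local Notation B := (reward A).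

Definition evolve (k : nat) (x : 'rV[R]_K) : 'rV[R]_K := x *m P ^+ k.

Definition linr (x : 'rV[R]_K) : R := (x *m B^T) 0 0.

(* The linearized threshold policy at subsidy [m], with [w] in the threshold;
   [true] is active.  The threshold function does not involve [m]. *)
Definition policy (m : R) (w : 'rV[R]_K) (x : 'rV[R]_K) : bool := linr w < linr x.

(* Belief state at time [t] along the state trajectory [s], from [w1]. *)
Fixpoint belief (m : R) (w w1 : 'rV[R]_K) (s : nat -> 'I_K) (t : nat) : 'rV[R]_K :=
  if t is t'.+1 then
    let x := belief m w w1 s t' in
    if policy m w x then row (s t') P else evolve 1 x
  else w1.

Definition active (m : R) (w w1 : 'rV[R]_K) (s : nat -> 'I_K) (t : nat) : bool :=
  policy m w (belief m w w1 s t).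

Section Performance.
Variables (X : chain A) (beta : R).

Definition total_reward (m : R) (w w1 : 'rV[R]_K) (s : nat -> 'I_K) : R :=
  limn (series (fun t => beta ^+ t *
    (if active m w w1 s t then B 0 (s t) else m))).

Definition total_passive (m : R) (w w1 : 'rV[R]_K) (s : nat -> 'I_K) : R :=
  limn (series (fun t => beta ^+ t * (~~ active m w w1 s t)%:R)).

(* The discounted sums converge and are bounded for 0 < beta < 1, so the
   expectations are finite. *)
Definition value (m : R) (w w1 : 'rV[R]_K) : R :=
  fine 'E_(law X w1)[fun o => total_reward m w w1 (fun t => state t o)]%E.

Definition passive_time (m : R) (w w1 : 'rV[R]_K) : R :=
  fine 'E_(law X w1)[fun o => total_passive m w w1 (fun t => state t o)]%E.

(* Equal performance of the two actions at [w] under subsidy [m]. *)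
Definition indifferent (w : 'rV[R]_K) (m : R) : Prop :=
  linr w + beta * (w *m \col_k value m w (row k P)) 0 0
    = m + beta * value m w (evolve 1 w).

(* Meaningful when exactly one subsidy makes the two actions indifferent. *)
Definition approx_whittle (w : 'rV[R]_K) : R := xget 0 [set m | indifferent w m].

End Performance.

Section ClosedForm.
Variables (beta : R) (w : 'rV[R]_K).

(* First crossing time; [None] stands for +oo. *)
Definition crossing_time (x : 'rV[R]_K) : option nat :=
  match pselect (exists k, linr w < linr (evolve k x)) with
  | left ex => Some (ex_minn ex)
  | right _ => None
  end.

Definition f_ (x : 'rV[R]_K) : R :=
  if crossing_time x is Some k then (1 - beta ^+ k) / (1 - beta)
  else 1 / (1 - beta).

Definition g_ (x : 'rV[R]_K) : 'rV[R]_K :=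
  if crossing_time x is Some k then beta ^+ k *: evolve k x else 0.

Definition F_ : 'cV[R]_K := \col_k f_ (row k P).
Definition G_ : 'M[R]_K := \matrix_k g_ (row k P).
Definition H_ : 'M[R]_K := invmx (1%:M - beta *: G_).

Definition whittle_num : R :=
  linr w
  - (beta *: (g_ (w *m P) *m (1%:M + beta *: (H_ *m G_)) *m B^T)) 0 0
  + (beta *: (w *m H_ *m G_ *m B^T)) 0 0.

Definition whittle_den : R :=
  1 + beta * f_ (w *m P)
  + (beta *: ((beta *: g_ (w *m P) - w) *m H_ *m F_)) 0 0.

End ClosedForm.
End SingleArm.

Definition relaxed_indexable (R : realType) (N : nat) (arms : 'I_N -> arm R)
    (X : forall a, chain (arms a)) (beta : R) : Prop :=
  forall (a : 'I_N) (w : 'rV[R]_(nstates (arms a))), is_distr w ->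
    exists! m : R, indifferent (X a) beta w m.

(* Main.v *)
(** Let [V(x)] be the expected payoff from belief [x] when active times pay
    [b_S] and passive times pay [c].  The expectation of the payoff truncated at
    horizon [n] is a finite sum over state paths, and satisfies a Bellman
    recursion in [n]; dominated convergence turns it into
      [V(x) = x (b + beta V(p))] if [x] is active, [V(x) = c + beta V(x P)]
    otherwise.  Unrolling the passive branch up to the first crossing time gives
    [V(x) = c f(x) + g(x) (b + beta V(p))], hence
    [V(p) = H (c F + G b)].  Payoffs [(b, c) = (B, m)] and [(0, 1)] give the value
    and the passive time; so the value is affine in [m] with slope the passive
    time, and indifference at [w] is a linear equation in [m] whose leading
    coefficient is the denominator of the index. *)

Require Import Defs.
From HB Require Import structures.
From mathcomp Require Import all_boot all_order all_algebra.
From mathcomp Require Import all_classical all_reals all_analysis.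
From mathcomp Require Import measurable_realfun ring.
Import Order.TTheory GRing.Theory Num.Theory.
Import numFieldNormedType.Exports.
Local Open Scope classical_set_scope.
Local Open Scope ring_scope.

Set Implicit Arguments.
Unset Strict Implicit.

(** * Belief states under passive evolution *)

Section BeliefStates.
Variables (R : realType) (A : arm R).
Local Notation K := (nstates A).
Local Notation P := (trans A).
Implicit Types (x : 'rV[R]_K) (i : 'I_K).

Lemma is_distr_row i : is_distr (row i P).
Proof. exact: trans_stochastic. Qed.

Lemma evolve0 x : evolve 0 x = x.
Proof. by rewrite /evolve expr0 -idmxE mulmx1. Qed.

Lemma evolveD m n x : evolve (m + n) x = evolve n (evolve m x).
Proof. by rewrite /evolve exprD -mulmxE mulmxA. Qed.

Lemma evolve1E x i : evolve 1 x 0 i = \sum_j x 0 j * P j i.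
Proof. by rewrite /evolve expr1 mxE. Qed.

Lemma is_distr_evolve n x : is_distr x -> is_distr (evolve n x).
Proof.
elim: n x => [|n IHn] x xd; first by rewrite evolve0.
rewrite -add1n evolveD; apply: IHn; case: xd => x0 x1; split.
  move=> i; rewrite evolve1E sumr_ge0// => j _; rewrite mulr_ge0//.
  by have [+ _] := is_distr_row j => /(_ i); rewrite mxE.
under eq_bigr do rewrite evolve1E.
rewrite exchange_big -[RHS]x1; apply: eq_bigr => j _ /=.
rewrite -mulr_sumr -[RHS]mulr1; congr (_ * _).
by have [_ <-] := is_distr_row j; apply: eq_bigr => i _; rewrite mxE.
Qed.

End BeliefStates.

(** * Truncated payoffs as finite sums over state paths *)

Section FiniteHorizon.
Variables (R : realType) (A : arm R) (beta : R).
Local Notation K := (nstates A).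
Local Notation P := (trans A).
(* The subsidy [m] is a dummy argument of [belief]; the payoff is [b] at active
   times and [c] at passive times, so that the reward is [(B, m)] and the
   passive time is [(0, 1)]. *)
Variables (m : R) (w b : 'rV[R]_K) (c : R).
Implicit Types (x : 'rV[R]_K) (s : nat -> 'I_K) (i : 'I_K).

Definition stage_payoff x s t : R := if active m w x s t then b 0 (s t) else c.

Definition partial_payoff n x s : R :=
  series (fun t => beta ^+ t * stage_payoff x s t) n.

Definition total_payoff x s : R :=
  limn (series (fun t => beta ^+ t * stage_payoff x s t)).

Definition next_belief x i : 'rV[R]_K :=
  if policy m w x then row i P else evolve 1 x.

(** [belief] unfolds at its last step, whereas the Bellman recursion peels off the first state;
    induction on [t] reconciles the two. *)
Lemma beliefS x s t : belief m w x s t.+1 =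
  belief m w (next_belief x (s 0%N)) (s \o succn) t.
Proof. by elim: t => [//|t IHt]; rewrite [LHS]/= -/(belief m w x s t.+1) IHt. Qed.

Lemma partial_payoffS n x s : partial_payoff n.+1 x s =
  (if policy m w x then b 0 (s 0%N) else c)
  + beta * partial_payoff n (next_belief x (s 0%N)) (s \o succn).
Proof.
rewrite /partial_payoff !seriesEnat /= big_nat_recl// expr0 mul1r mulr_sumr.
congr (_ + _); apply: eq_bigr => t _; rewrite exprS mulrA /stage_payoff.
by rewrite /active beliefS.
Qed.

Lemma eq_partial_payoff n x s s' : (forall t, (t < n)%N -> s t = s' t) ->
  partial_payoff n x s = partial_payoff n x s'.
Proof.
elim: n x s s' => [|n IHn] x s s' ss'; first by rewrite /partial_payoff !seriesEnat/= !big_geq.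
rewrite !partial_payoffS ss'// (IHn _ (s \o succn) (s' \o succn))// => t tn.
exact: ss'.
Qed.

(** The recursion restarts from [row i P], the belief after observing [i], so that the active branch
    of the Bellman recursion needs no rewriting of probabilities. *)
Fixpoint path_prob x (l : seq 'I_K) : R :=
  if l is i :: l' then x 0 i * path_prob (row i P) l' else 1.

Lemma path_probE (i0 : 'I_K) x l : l != [::] -> path_prob x l =
  x 0 (nth i0 l 0) * \prod_(t < (size l).-1) P (nth i0 l t) (nth i0 l t.+1).
Proof.
elim: l x => [//|i [|j l] IHl] x _; first by rewrite /= big_ord0.
by rewrite [LHS]/= -/(path_prob _ (j :: l)) IHl// mxE big_ord_recl.
Qed.

Lemma path_prob_ge0 x l : is_distr x -> 0 <= path_prob x l.
Proof.
elim: l x => [//|i l IHl] x xd /=; rewrite mulr_ge0//; first exact: (proj1 xd).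
exact/IHl/is_distr_row.
Qed.

Lemma big_tuple_cons n (F : n.+1.-tuple 'I_K -> R) :
  \sum_t F t = \sum_i \sum_(t : n.-tuple 'I_K) F [tuple of i :: t].
Proof.
rewrite pair_big (reindex (fun p : 'I_K * n.-tuple 'I_K => [tuple of p.1 :: p.2]))//=.
exists (fun t : n.+1.-tuple 'I_K => (thead t, [tuple of behead t])) => [[i t] _|t _] /=.
  by congr pair; exact: val_inj.
by rewrite -tuple_eta.
Qed.

Lemma sum_path_prob n x : is_distr x ->
  \sum_(t : n.-tuple 'I_K) path_prob x t = 1.
Proof.
elim: n x => [|n IHn] x xd.
  by rewrite (big_pred1 [tuple])// => t; rewrite [t]tuple0; apply/esym/eqP.
rewrite big_tuple_cons -[RHS](proj2 xd); apply: eq_bigr => i _ /=.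
by rewrite -mulr_sumr IHn ?mulr1//; exact: is_distr_row.
Qed.

(** Summing out an unobserved first state moves the belief one passive step forward; the empty path
    uses that [x] has mass 1. *)
Lemma sum_path_prob_row x l : is_distr x ->
  \sum_i x 0 i * path_prob (row i P) l = path_prob (evolve 1 x) l.
Proof.
case: l => [|j l] xd /=; first by under eq_bigr do rewrite mulr1; exact: (proj2 xd).
by rewrite evolve1E mulr_suml; apply: eq_bigr => i _; rewrite mxE mulrA.
Qed.

(** [i0] is only the default of [nth]; it is never read, since the payoff at horizon [n] depends on
    the first [n] states alone. *)
Definition horizon_value (i0 : 'I_K) n x : R :=
  \sum_(t : n.-tuple 'I_K) path_prob x t * partial_payoff n x (nth i0 t).

(** Paths are split at their first state. In the passive case the next belief does not depend on
    that state, so it can be summed out first. *)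
Lemma horizon_valueS i0 n x : is_distr x -> horizon_value i0 n.+1 x =
  if policy m w x
  then \sum_i x 0 i * (b 0 i + beta * horizon_value i0 n (row i P))
  else c + beta * horizon_value i0 n (evolve 1 x).
Proof.
move=> xd; rewrite /horizon_value big_tuple_cons; case: ifPn => act.
  (* The factor 1 before [b 0 i] becomes the total mass of the paths from [row i P], so that both
     sides are sums over the same tuples. *)
  apply: eq_bigr => i _; rewrite mulrDr -{1}[b 0 i]mul1r.
  rewrite -(sum_path_prob n (is_distr_row i)) mulr_suml !mulr_sumr -big_split/=.
  apply: eq_bigr => t _; rewrite partial_payoffS /= /next_belief act.
  by ring.
rewrite exchange_big /= -{1}[c]mul1r.
rewrite -(sum_path_prob n (is_distr_evolve 1 xd)) mulr_suml mulr_sumr -big_split/=.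
apply: eq_bigr => t _; rewrite -sum_path_prob_row// !mulr_suml mulr_sumr -big_split/=.
apply: eq_bigr => i _; rewrite partial_payoffS /= /next_belief (negbTE act).
by ring.
Qed.

End FiniteHorizon.

(** * Passage to the infinite horizon *)

Section InfiniteHorizon.
Variables (R : realType) (A : arm R) (X : chain A) (beta : R).
Hypothesis beta01 : 0 < beta < 1.
Local Notation K := (nstates A).
Local Notation P := (trans A).
Variables (m : R) (w b : 'rV[R]_K) (c : R).
Implicit Types (x : 'rV[R]_K) (s : nat -> 'I_K) (i : 'I_K).
Local Notation partial := (partial_payoff beta m w b c).
Local Notation total := (total_payoff beta m w b c).
Local Notation U := (horizon_value beta m w b c).
Local Notation trajectory o := (fun t => state (c := X) t o).

Definition payoff_bound : R := `|c| + \sum_i `|b 0 i|.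

Lemma payoff_bound_ge0 : 0 <= payoff_bound.
Proof. by rewrite addr_ge0// sumr_ge0. Qed.

Lemma stage_payoff_le x s t : `|stage_payoff m w b c x s t| <= payoff_bound.
Proof.
rewrite /stage_payoff /payoff_bound; case: ifP => _; last by rewrite lerDl sumr_ge0.
by rewrite (bigD1 (s t))//= addrCA lerDl addr_ge0// sumr_ge0.
Qed.

Let beta_ge0 : 0 <= beta. Proof. by case/andP: beta01 => /ltW. Qed.
Let beta_norm : `|beta| < 1. Proof. by rewrite ger0_norm//; case/andP: beta01. Qed.

Lemma discounted_payoff_le x s t :
  `|beta ^+ t * stage_payoff m w b c x s t| <= geometric payoff_bound beta t.
Proof.
rewrite normrM ger0_norm ?exprn_ge0// /geometric /= mulrC.
by rewrite ler_wpM2r ?exprn_ge0// stage_payoff_le.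
Qed.

Lemma is_cvg_normed_payoff x s :
  cvgn [normed series (fun t => beta ^+ t * stage_payoff m w b c x s t)].
Proof.
apply: (series_le_cvg _ _ (discounted_payoff_le x s)).
- by move=> n; exact: normr_ge0.
- by move=> n; rewrite /geometric /= mulr_ge0 ?exprn_ge0 ?payoff_bound_ge0.
- exact: is_cvg_geometric_series.
Qed.

Lemma cvg_partial_payoff x s : partial n x s @[n --> \oo] --> total x s.
Proof. exact/normed_cvg/is_cvg_normed_payoff. Qed.

(** The bound is uniform in the horizon and the trajectory, hence serves as the dominating constant
    for the limit of expectations. *)
Lemma partial_payoff_le n x s : `|partial n x s| <= payoff_bound / (1 - beta).
Proof.
have b1 : 0 < 1 - beta by rewrite subr_gt0; case/andP: beta01.
rewrite /partial_payoff seriesEnat /= (le_trans (ler_norm_sum _ _ _))//.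
apply: (le_trans (ler_sum _ (fun t _ => discounted_payoff_le x s t))).
have := @geometric_seriesE R payoff_bound beta; rewrite lt_eqF; last by case/andP: beta01.
move=> /(_ isT)/(congr1 (@^~ n)); rewrite seriesEnat /= => ->.
rewrite ler_pM2r ?invr_gt0// ler_piMr ?payoff_bound_ge0//.
by rewrite gerBl exprn_ge0.
Qed.

Definition expected_payoff x : R := fine 'E_(law X x)[fun o => total x (trajectory o)].

Section Expectation.
Variable i0 : 'I_K.

Definition cylinder n (t : n.+1.-tuple 'I_K) : set (Defs.space X) :=
  [set o | forall k, (k <= n)%N -> state (c := X) k o = nth i0 t k].

Lemma measurable_cylinder n (t : n.+1.-tuple 'I_K) : measurable (cylinder t).
Proof.
rewrite (_ : cylinder t = \bigcap_(k in `I_n.+1) (state (c := X) k @^-1` [set nth i0 t k])) //.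
by rewrite bigcap_mkord; apply: big_ind => // [|k _]; [exact: measurableI|exact: state_measurable].
Qed.

Lemma law_cylinder x n (t : n.+1.-tuple 'I_K) : is_distr x ->
  law X x (cylinder t) = (path_prob x t)%:E.
Proof.
move=> xd; rewrite [LHS](state_markov X xd) (path_probE i0) ?size_tuple//.
by rewrite -size_eq0 size_tuple.
Qed.

(** The cylinders partition the sample space, and the truncated payoff is constant on each of
    them. *)
Lemma partial_payoff_indic n x o : partial n.+1 x (trajectory o) =
  \sum_(t : n.+1.-tuple 'I_K) partial n.+1 x (nth i0 t) * \1_(cylinder t) o.
Proof.
(* The states actually visited along [o]: only their cylinder contributes to the sum. *)
pose t0 := [tuple state (c := X) k o | k < n.+1].
have t0E k : (k <= n)%N -> nth i0 t0 k = state (c := X) k o.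
  by move=> kn; rewrite -[k]/(val (Ordinal (kn : (k < n.+1)%N))) -tnth_nth tnth_mktuple.
rewrite (bigD1 t0)//= indicE mem_set ?mulr1; last by move=> k kn; rewrite t0E.
rewrite big1 ?addr0; first by apply: eq_partial_payoff => k kn; rewrite t0E.
move=> t tt0; rewrite indicE memNset ?mulr0// => ct; case/eqP: tt0.
apply/val_inj/(@eq_from_nth _ i0); rewrite ?size_tuple// => k kn.
by rewrite t0E// ct.
Qed.

Lemma measurable_partial_payoff n x :
  measurable_fun setT (fun o => partial n x (trajectory o)).
Proof.
case: n => [|n].
  by under eq_fun do rewrite /partial_payoff seriesEnat /= big_geq//; exact: measurable_cst.
under eq_fun do rewrite partial_payoff_indic.
apply: measurable_sum => t; apply: measurable_funM; first exact: measurable_cst.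
exact/measurable_indic/measurable_cylinder.
Qed.

Lemma integral_partial_payoff n x : is_distr x ->
  (\int[law X x]_o (partial n.+1 x (trajectory o))%:E)%E = (U i0 n.+1 x)%:E.
Proof.
move=> xd; under eq_integral do rewrite partial_payoff_indic -sumEFin.
have indI t : (law X x).-integrable setT (EFin \o \1_(@cylinder n t)).
  apply: measurable_bounded_integrable => //.
  - by rewrite (le_lt_trans (probability_le1 _ _)) ?ltry.
  - exact/measurable_indic/measurable_cylinder.
  - exists 1; split=> // r r1 o _ /=; rewrite (le_trans _ (ltW r1))//.
    by rewrite indicE; case: (_ \in _); rewrite ?normr1 ?normr0.
rewrite integral_sum//.
  rewrite /horizon_value -sumEFin; apply: eq_bigr => t _.
  under eq_integral do rewrite EFinM.
  rewrite (integralZl measurableT (indI t)) [X in (_ * X)%E](_ : _ = law X x (cylinder t)).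
    by rewrite law_cylinder// muleC.
  by rewrite [LHS]integral_indic ?setIT//; exact: measurable_cylinder.
by move=> t; exact: integrableZl (indI t).
Qed.

(** Dominated convergence: the integrals of the truncated payoffs are the finite path sums. *)
Lemma cvg_horizon_value x : is_distr x ->
  U i0 n x @[n --> \oo] --> expected_payoff x.
Proof.
(* Horizon 0 is dropped because a cylinder always fixes the initial state. *)
move=> xd; rewrite -cvg_shiftS /expected_payoff unlock.
have [] := @dominated_convergence _ _ _ (law X x) setT measurableT
  (fun n o => (partial n.+1 x (trajectory o))%:E) (fun o => (total x (trajectory o))%:E)
  (cst (payoff_bound / (1 - beta))%:E).
- by move=> n; apply/measurable_EFinP/measurable_partial_payoff.
- apply/measurable_EFinP/(measurable_fun_cvg (h := fun n o => partial n x (trajectory o))).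
    by move=> n; exact: measurable_partial_payoff.
  by move=> o _; exact: cvg_partial_payoff.
- apply/aeW => o _; apply: cvg_EFin; first exact: nearW.
  have := @cvg_partial_payoff x (trajectory o); rewrite -cvg_shiftS; exact.
- exact: finite_measure_integrable_cst.
- by apply/aeW => o n _; rewrite lee_fin; exact: partial_payoff_le.
move=> totalI _; under eq_fun do rewrite integral_partial_payoff//.
rewrite -[X in _ --> X -> _]fineK; first by move=> /fine_cvg.
exact: integrable_fin_num.
Qed.

End Expectation.

(** Limit of [horizon_valueS] on both sides, by uniqueness of limits. *)
Lemma expected_payoffE x : is_distr x -> expected_payoff x =
  if policy m w x then \sum_i x 0 i * (b 0 i + beta * expected_payoff (row i P))
  else c + beta * expected_payoff (evolve 1 x).
Proof.
move=> xd; have i0 : 'I_K := Ordinal (nstates_gt0 A).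
have := cvg_horizon_value i0 xd; rewrite -cvg_shiftS => /cvg_lim <-//.
under eq_fun do rewrite horizon_valueS//; apply/cvg_lim => //; case: ifP => _.
  apply: (cvg_big add_continuous) => i _; apply: cvgMl_tmp; apply: cvgD; first exact: cvg_cst.
  by apply: cvgMl_tmp; apply: cvg_horizon_value; exact: is_distr_row.
apply: cvgD; first exact: cvg_cst.
by apply: cvgMl_tmp; apply: cvg_horizon_value; exact: is_distr_evolve.
Qed.

Lemma expected_payoff_le x : is_distr x ->
  `|expected_payoff x| <= payoff_bound / (1 - beta).
Proof.
move=> xd; have i0 : 'I_K := Ordinal (nstates_gt0 A).
apply: (cvgr_to_le (cvg_norm (cvg_horizon_value i0 xd))).
apply: nearW => n; rewrite (le_trans (ler_norm_sum _ _ _))//.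
rewrite -[leRHS]mul1r -{1}(sum_path_prob n xd) mulr_suml; apply: ler_sum => t _.
rewrite normrM ger0_norm ?path_prob_ge0//.
by rewrite ler_wpM2l ?path_prob_ge0// partial_payoff_le.
Qed.

End InfiniteHorizon.

(** * Closed forms through the first crossing time *)

Section CrossingDecomposition.
Variables (R : realType) (A : arm R) (X : chain A) (beta : R).
Hypothesis beta01 : 0 < beta < 1.
Local Notation K := (nstates A).
Local Notation P := (trans A).
Local Notation B := (reward A).
Variables (w : 'rV[R]_K).
Implicit Types (x b : 'rV[R]_K) (i : 'I_K) (m c : R).
Local Notation f := (f_ beta w).
Local Notation g := (g_ beta w).
Local Notation F := (F_ beta w).
Local Notation G := (G_ beta w).
Local Notation H := (H_ beta w).

Let beta_ge0 : 0 <= beta. Proof. by case/andP: beta01 => /ltW. Qed.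
Let beta_le1 : beta <= 1. Proof. by case/andP: beta01 => _ /ltW. Qed.
Let beta_norm : `|beta| < 1. Proof. by rewrite ger0_norm//; case/andP: beta01. Qed.
Let beta1_neq0 : 1 - beta != 0.
Proof. by rewrite subr_eq0 eq_sym lt_eqF//; case/andP: beta01. Qed.

Lemma g_ge0 x i : is_distr x -> 0 <= g x 0 i.
Proof.
move=> xd; rewrite /g_; case: crossing_time => [k|]; rewrite mxE//.
by rewrite mulr_ge0 ?exprn_ge0//; case: (is_distr_evolve k xd) => /(_ i).
Qed.

Lemma sum_g_le1 x : is_distr x -> \sum_i g x 0 i <= 1.
Proof.
move=> xd; rewrite /g_; case: crossing_time => [k|].
  under eq_bigr do rewrite mxE.
  by rewrite -mulr_sumr (proj2 (is_distr_evolve k xd)) mulr1 exprn_ile1.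
by rewrite big1// => i _; rewrite mxE.
Qed.

(* [G] is substochastic, so [v = beta v G] contracts the l1 norm of [v]. *)
Lemma unitmx_sub_G : 1%:M - beta *: G \in unitmx.
Proof.
rewrite unitmxE unitfE; apply/negP => /det0P[v /negP v0 vE]; apply: v0; move/eqP: vE.
rewrite mulmxBr mulmx1 subr_eq0 -scalemxAr => /eqP vE.
have vle : \sum_j `|v 0 j| <= beta * \sum_j `|v 0 j|.
  rewrite {1}vE; under eq_bigr do rewrite mxE normrM ger0_norm// mxE.
  rewrite -mulr_sumr ler_wpM2l//.
  apply: (le_trans (ler_sum _ (fun j _ => ler_norm_sum _ _ _))).
  rewrite exchange_big; apply: ler_sum => i _ /=.
  have normG j : `|v 0 i * G i j| = `|v 0 i| * g (row i P) 0 j.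
    by rewrite normrM mxE [`|g _ _ _|]ger0_norm// g_ge0//; exact: is_distr_row.
  rewrite (eq_bigr _ (fun j _ => normG j)) -mulr_sumr ler_piMr//; apply: sum_g_le1; exact: is_distr_row.
have sum0 : \sum_j `|v 0 j| = 0.
  apply/eqP; rewrite eq_le sumr_ge0// andbT leNgt; apply/negP => sum_gt0.
  by move: vle; rewrite leNgt gtr_pMl// (andP beta01).2.
apply/eqP/rowP => j; rewrite mxE; apply/normr0_eq0.
exact: (psumr_eq0P _ sum0).
Qed.

Section Payoff.
Variables (m : R) (b : 'rV[R]_K) (c : R).
Local Notation V := (expected_payoff X beta m w b c).
Local Notation Vp := (\col_i V (row i P)).

(** [c / (1 - beta)] is the fixed point of the passive recursion [v = c + beta * v], so each passive
    step multiplies the deviation from it by [beta]. *)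
Lemma expected_payoff_passive k x : is_distr x ->
    (forall j, (j < k)%N -> ~~ (linr w < linr (evolve j x))) ->
  V x - c / (1 - beta) = beta ^+ k * (V (evolve k x) - c / (1 - beta)).
Proof.
elim: k x => [|k IHk] x xd xpas; first by rewrite expr0 mul1r evolve0.
rewrite (expected_payoffE X beta01)// /policy ifF; last first.
  by apply/negbTE; have := xpas 0%N isT; rewrite evolve0.
rewrite -[k.+1]add1n evolveD add1n exprS -mulrA -IHk.
- by field.
- exact: is_distr_evolve.
- by move=> j jk; rewrite -evolveD; apply: xpas; rewrite ltnS.
Qed.

(** At a finite crossing time the active Bellman equation applies to the evolved belief. Without
    crossing, the deviation from [c / (1 - beta)] is at most a constant times [beta ^+ k] for every
    [k], hence zero. *)
Lemma expected_payoff_crossing x : is_distr x ->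
  V x = c * f x + (g x *m (b^T + beta *: Vp)) 0 0.
Proof.
move=> xd; rewrite /f_ /g_ /crossing_time.
case: pselect => [ex|nex].
  case: ex_minnP => k kact kmin.
  have xpas j : (j < k)%N -> ~~ (linr w < linr (evolve j x)).
    by apply: contraL => /kmin; rewrite -leqNgt.
  rewrite -[LHS](subrK (c / (1 - beta))) (expected_payoff_passive xd xpas).
  rewrite [V _](expected_payoffE X beta01); last exact: is_distr_evolve.
  rewrite /policy kact -scalemxAl; move: (evolve k x) => y; rewrite !mxE.
  under [in RHS]eq_bigr do rewrite !mxE.
  by field.
rewrite mul0mx mxE addr0 div1r; apply/eqP; rewrite -subr_eq0 -normr_le0.
(* [M] bounds the deviation at every belief state, by the triangle inequality. *)
set M := payoff_bound b c / (1 - beta) + `|c / (1 - beta)|.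
apply: (cvgr_to_ge (cvg_geometric M beta_norm)); apply: nearW => k /=.
rewrite (expected_payoff_passive (k := k) xd).
  rewrite normrM normrX (ger0_norm beta_ge0) mulrC ler_wpM2r ?exprn_ge0//.
  rewrite (le_trans (ler_normB _ _))// lerD2r expected_payoff_le//.
  exact: is_distr_evolve.
by move=> j _; apply/negP => act; apply: nex; exists j.
Qed.

(** The crossing formula at the rows of [P] is a linear system for [Vp] with the invertible matrix
    [1%:M - beta *: G]. *)
Lemma expected_payoff_restart : Vp = H *m (c *: F + G *m b^T).
Proof.
apply: (can_inj (mulKmx unitmx_sub_G)); rewrite mulKVmx ?unitmx_sub_G//.
rewrite mulmxBl mul1mx -scalemxAl; apply/eqP; rewrite subr_eq; apply/eqP.
rewrite -addrA scalemxAr -mulmxDr; apply/colP => i.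
rewrite !mxE expected_payoff_crossing; last exact: is_distr_row.
by congr (_ + _); rewrite mxE; apply: eq_bigr => j _; rewrite [G _ _]mxE.
Qed.

Lemma expected_payoff_closed x : is_distr x ->
  V x = c * f x + (g x *m (b^T + beta *: (H *m (c *: F + G *m b^T)))) 0 0.
Proof. by move=> xd; rewrite -expected_payoff_restart expected_payoff_crossing. Qed.

End Payoff.

(** Slope of the value in the subsidy; [reward_closed] is its intercept. *)
Definition passive_closed x : R := f x + beta * (g x *m H *m F) 0 0.

Definition reward_closed x : R :=
  (g x *m (1%:M + beta *: (H *m G)) *m B^T) 0 0.

Lemma passive_time_payoff m x :
  passive_time X beta m w x = expected_payoff X beta m w 0 1 x.
Proof.
rewrite /passive_time /expected_payoff; congr (fine ('E__[_])); apply/funext => o.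
rewrite /total_passive /total_payoff; congr (limn (series _)); apply/funext => t.
by rewrite /stage_payoff mxE; case: active.
Qed.

Lemma passive_timeE m x : is_distr x -> passive_time X beta m w x = passive_closed x.
Proof.
move=> xd; rewrite passive_time_payoff expected_payoff_closed//.
rewrite trmx0 mulmx0 addr0 add0r scale1r mul1r.
by rewrite -scalemxAr mulmxA mxE.
Qed.

Lemma valueE m x : is_distr x ->
  value X beta m w x = reward_closed x + m * passive_closed x.
Proof.
(* [value] is convertible to [expected_payoff] for the payoffs [(B, m)]. *)
move=> xd; rewrite [LHS](expected_payoff_closed m B m xd).
rewrite /reward_closed /passive_closed !(mulmxDr, mulmxDl) -?(scalemxAl, scalemxAr).
rewrite !mulmxDr -?(scalemxAl, scalemxAr) !mulmxA mulmx1.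
move: (g x *m B^T) (g x *m H *m F) (g x *m H *m G *m B^T) => u v z.
rewrite !mxE; ring.
Qed.

Lemma passive_time_restart m :
  \col_i passive_time X beta m w (row i P) = H *m F.
Proof.
under eq_mx do rewrite passive_time_payoff.
by rewrite expected_payoff_restart trmx0 mulmx0 addr0 scale1r.
Qed.

Lemma whittle_denE m : is_distr w -> whittle_den beta w =
  1 + beta * passive_time X beta m w (evolve 1 w)
  - beta * (w *m \col_i passive_time X beta m w (row i P)) 0 0.
Proof.
move=> wd; rewrite passive_time_restart passive_timeE; last exact: is_distr_evolve.
rewrite /whittle_den /passive_closed /evolve expr1 !mulmxBl -!scalemxAl mulmxA.
move: (g (w *m P) *m H *m F) (w *m H *m F) => u v.
by rewrite !mxE; ring.
Qed.

Lemma indifferentE m : is_distr w ->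
  indifferent X beta w m <-> m * whittle_den beta w = whittle_num beta w.
Proof.
move=> wd; rewrite /indifferent valueE; last exact: is_distr_evolve.
rewrite [\col_k _](expected_payoff_restart m B m).
rewrite /whittle_den /whittle_num /passive_closed /reward_closed /evolve expr1.
rewrite !mulmxBl -!scalemxAl !mulmxDr -!scalemxAr !mulmxA mulmx1 !mulmxDl -!scalemxAl.
move: (g _ *m B^T) (g _ *m H *m F) (g _ *m H *m G *m B^T) => u v z.
move: (w *m H *m F) (w *m H *m G *m B^T) => p q.
(* Equivalence of the two equations reduces to one identity between differences of sides, within
   reach of [ring]. *)
have eqE (s t y y' : R) : t - s = y - y' -> s = t <-> y = y'.
  move=> h; split=> e; apply/eqP.
    by rewrite -subr_eq0 -h e subrr.
  by rewrite eq_sym -subr_eq0 h e subrr.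
by rewrite !mxE; apply: eqE; ring.
Qed.

End CrossingDecomposition.

(** * Solving the linear indifference equation for the subsidy *)

Lemma exists_unique_root (F : fieldType) (a b : F) :
  (exists! x, x * a = b) <-> a <> 0.
Proof.
split=> [[x [xab xuniq]] a0|/eqP a0].
  (* With a zero coefficient, any root [x] makes [x + 1] a second root. *)
  have /eqP : x = x + 1 by apply: xuniq; rewrite a0 mulr0 -xab a0 mulr0.
  by rewrite eq_sym -subr_eq0 addrC addKr oner_eq0.
exists (b / a); split=> [|y yab]; first by rewrite divfK.
by rewrite -yab mulfK.
Qed.

Theorem theorem3 (R : realType) (N : nat) (arms : 'I_N -> arm R)
    (X : forall a : 'I_N, chain (arms a)) (beta : R)
    (hbeta : 0 < beta < 1) :
  (* the passive time is the derivative of the value function in the subsidy,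
     and does not depend on the subsidy *)
  (forall (a : 'I_N) (w w1 : 'rV[R]_(nstates (arms a))),
     is_distr w -> is_distr w1 ->
     (forall m : R, is_derive m (1 : R) (fun m' : R => value (X a) beta m' w w1)
                      (passive_time (X a) beta m w w1)) /\
     (forall m m' : R, passive_time (X a) beta m w w1
                       = passive_time (X a) beta m' w w1)) /\
  (relaxed_indexable X beta <->
   forall (a : 'I_N) (m : R) (w : 'rV[R]_(nstates (arms a))), is_distr w ->
     beta * (w *m \col_k passive_time (X a) beta m w (row k (trans (arms a)))) 0 0
       <> 1 + beta * passive_time (X a) beta m w (evolve 1 w)) /\
  (relaxed_indexable X beta ->
   forall (a : 'I_N) (w : 'rV[R]_(nstates (arms a))), is_distr w ->
     [/\ 1%:M - beta *: G_ beta w \in unitmx,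
         whittle_den beta w <> 0
       & approx_whittle (X a) beta w = whittle_num beta w / whittle_den beta w]).
Proof.
(* Indifference at [w] is linear in the subsidy, so unique solvability means a nonzero leading
   coefficient. *)
have indexP : relaxed_indexable X beta <->
    forall a (w : 'rV[R]_(nstates (arms a))), is_distr w -> whittle_den beta w <> 0.
  split=> idx a w wd.
    apply/(exists_unique_root _ (whittle_num beta w)); have [m [mI mU]] := idx a w wd.
    by exists m; split=> [|y yE]; [exact/(indifferentE (X a))|exact/mU/indifferentE].
  have [m [mI mU]] := (exists_unique_root _ (whittle_num beta w)).2 (idx a w wd).
  by exists m; split=> [|y yE]; [exact/indifferentE|exact/mU/(indifferentE (X a))].
split; [|split].
- move=> a w w1 wd w1d; split=> [m|m m']; last by rewrite !passive_timeE.
  rewrite passive_timeE//; under eq_fun do rewrite valueE//.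
  have affine := is_deriveD (is_derive_cst (reward_closed beta w w1) m (1 : R))
    (is_deriveM (is_derive_id m (1 : R)) (is_derive_cst (passive_closed beta w w1) m (1 : R))).
  by apply: (is_derive_eq affine); rewrite scaler0 !add0r; exact: mulr1.
- rewrite indexP; split=> [den0 a m w wd E|neq a w wd].
    by apply: (den0 a w wd); rewrite (whittle_denE (X a) hbeta m)// E subrr.
  (* The subsidy 0 is an arbitrary choice: [whittle_den] does not involve it. *)
  rewrite (whittle_denE (X a) hbeta 0)// => /eqP; rewrite subr_eq0 => /eqP/esym.
  exact: neq.
- move=> idx a w wd; have den0 := indexP.1 idx a w wd; split=> //.
    exact: unitmx_sub_G.
  (* The default value of [xget] would arise only if no subsidy gave indifference, which
     indexability excludes. *)
  rewrite /approx_whittle; case: xgetP => [m _ mI|noI].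
    have /(indifferentE (X a) hbeta _ wd) <- : indifferent (X a) beta w m by [].
    by rewrite mulfK//; apply/eqP.
  have [m [mI _]] := idx a w wd.
  by case: (noI m).
Qed.
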